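(* Let $P$ be a finite poset, let $\alpha,\beta:P\to\mathbb{R}$ be order-decreasing, and let $$A=\sum_{i\in P}\alpha(i)|a_i\rangle\langle a_i|,\qquad B=\sum_{j\in P}\beta(j)|b_j\rangle\langle b_j|$$ be spectral decompositions of Hermitian matrices in orthonormal bases $(a_i)_{i\in P}$ and $(b_j)_{j\in P}$ indexed by $P$. If the matrix $C\in\mathbb{C}^{P\times P}$ with entries $C_{ij}:=\langle a_i,b_j\rangle$ satisfies $C\in\overline{\mathcal{L}(P)\,\mathcal{U}(P)}$, then $$\lambda(A+B)\prec\lambda(D_{\alpha+\beta})\prec\lambda(A)+\lambda(B),$$ where $D_{\alpha+\beta}$ is the diagonal matrix with diagonal entries $\big(\alpha(x)+\beta(x)\big)_{x\in P}$.
   Context: Matrices in $\mathbb{C}^{P\times P}$ have rows and columns indexed by the finite set $P$. A function $f:P\to\mathbb{R}$ on a poset is order-decreasing if $x\le y$ implies $f(x)\ge f(y)$. For a finite poset $P$, $$\mathcal{L}(P):=\{L\in\mathbb{C}^{P\times P}\mid L_{xy}=0\text{ unless }y\le x\},\qquad \mathcal{U}(P):=\{U\in\mathbb{C}^{P\times P}\mid U_{xy}=0\text{ unless }x\le y\},$$ $\mathcal{L}(P)\,\mathcal{U}(P)=\{LU\mid L\in\mathcal{L}(P),U\in\mathcal{U}(P)\}$, and the bar denotes the closure in the norm topology (so $C\in\overline{\mathcal{L}(P)\mathcal{U}(P)}$ means there are $L_n\in\mathcal{L}(P)$, $U_n\in\mathcal{U}(P)$ with $L_nU_n\to C$). For a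 Hermitian $d\times d$ matrix $X$, $\lambda(X)=(\lambda_1(X),\dots,\lambda_d(X))$ is the vector of eigenvalues (with multiplicity) in decreasing order. For $x,y\in\mathbb{R}^d$, majorization $x\prec y$ means $\sum_{i=1}^k x_i^\downarrow\le\sum_{i=1}^k y_i^\downarrow$ for all $k\in\{1,\dots,d\}$ with equality for $k=d$, where $\downarrow$ denotes decreasing rearrangement. *)

(* Defs.v *)
From HB Require Import structures.
From mathcomp Require Import all_boot all_order all_algebra.
From mathcomp Require Import sesquilinear spectral.
From mathcomp.real_closed Require Import complex.
From mathcomp Require Import all_classical all_reals topology normedtype.

Set Implicit Arguments.
Unset Strict Implicit.
Unset Printing Implicit Defensive.

Import Order.TTheory GRing.Theory Num.Theory.
Import numFieldNormedType.Exports.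

Local Open Scope classical_set_scope.
Local Open Scope sesquilinear_scope.
Local Open Scope complex_scope.
Local Open Scope ring_scope.

(* The topology of the modulus on R[i]; 'M[R[i]]_(m, n) then carries the
   topology of the entrywise sup norm. *)
HB.instance Definition _ (R : realType) :=
  PseudoMetricNormedZmod.copy R[i] (R[i]^o).

(* A matrix with rows and columns indexed by the finite type P is
   an M : 'M_#|P|, whose (x, y) entry is M (enum_rank x) (enum_rank y). *)

Section PosetMatrices.
Variables (R : realType) (d : Order.disp_t) (P : finPOrderType d).

Definition order_decreasing (f : P -> R) : Prop :=
  forall x y : P, (x <= y)%O -> f y <= f x.

Definition lower_mx : set 'M[R[i]]_#|P| :=
  [set L | forall x y : P,
     ~~ (y <= x)%O -> L (enum_rank x) (enum_rank y) = 0].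

Definition upper_mx : set 'M[R[i]]_#|P| :=
  [set U | forall x y : P,
     ~~ (x <= y)%O -> U (enum_rank x) (enum_rank y) = 0].

Definition lower_upper_mx : set 'M[R[i]]_#|P| :=
  [set L *m U | L in lower_mx & U in upper_mx].

End PosetMatrices.

Section OrthonormalBases.
Variables (R : realType) (T : finType) (n : nat).

(* Conjugate-linear in the first argument. *)
Definition inner (u v : 'cV[R[i]]_n) : R[i] := (u ^t* *m v) 0 0.

Definition orthonormal_basis (a : T -> 'cV[R[i]]_n) : Prop :=
  (forall i j, inner (a i) (a j) = (i == j)%:R) /\
  (forall v : 'cV[R[i]]_n, exists c : T -> R[i], v = \sum_i c i *: a i).

Definition overlap_mx (a b : T -> 'cV[R[i]]_n) : 'M[R[i]]_#|T| :=
  \matrix_(k, l) inner (a (enum_val k)) (b (enum_val l)).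

Definition spectral_sum (f : T -> R) (a : T -> 'cV[R[i]]_n) : 'M[R[i]]_n :=
  \sum_i (f i)%:C *: (a i *m (a i) ^t*).

Definition diag_fun_mx (f : T -> R) : 'M[R[i]]_#|T| :=
  diag_mx (\row_k (f (enum_val k))%:C).

End OrthonormalBases.

Section Majorization.
Variable R : realType.

Definition decreasing_rearrangement n (x : 'rV[R]_n) : 'rV[R]_n :=
  \row_k (sort >=%R [seq x 0 j | j <- enum 'I_n])`_k.

Definition majorized n (x y : 'rV[R]_n) : Prop :=
  let x' := decreasing_rearrangement x in
  let y' := decreasing_rearrangement y in
  (forall k, (0 < k <= n)%N ->
     \sum_(i < n | (i < k)%N) x' 0 i <= \sum_(i < n | (i < k)%N) y' 0 i) /\
  \sum_(i < n) x' 0 i = \sum_(i < n) y' 0 i.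

End Majorization.

Section HermitianEigenvalues.
Variable R : realType.

Definition char_roots n (X : 'M[R[i]]_n) : seq R[i] :=
  sval (closed_field_poly_normal (char_poly X)).

(* Meant for Hermitian X, whose characteristic roots are real (see
   char_poly_eigvals); on other matrices it sorts the real parts. *)
Definition eigvals n (X : 'M[R[i]]_n) : 'rV[R]_n :=
  \row_k (sort >=%R [seq complex.Re z | z <- char_roots X])`_k.

Lemma char_rootsE n (X : 'M[R[i]]_n) :
  char_poly X = \prod_(z <- char_roots X) ('X - z%:P).
Proof.
rewrite /char_roots; case: closed_field_poly_normal => r /= {1}->.
by rewrite (monicP (char_poly_monic X)) scale1r.
Qed.

Lemma size_char_roots n (X : 'M[R[i]]_n) : size (char_roots X) = n.
Proof.
have := size_char_poly X.
by rewrite char_rootsE size_prod_XsubC => -[].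
Qed.

Lemma char_root_real n (X : 'M[R[i]]_n) (z : R[i]) :
  X \is hermsymmx -> z \in char_roots X -> (complex.Re z)%:C = z.
Proof.
move=> /is_hermitianmxP; rewrite expr0 scale1r => hX zX.
have /eigenvalueP[v vX v0] : eigenvalue X z.
  by rewrite eigenvalue_root_char char_rootsE root_prod_XsubC.
have e1 : v *m X *m v ^t* = z *: (v *m v ^t*) by rewrite vX scalemxAl.
have e2 : v *m X *m v ^t* = z^* *: (v *m v ^t*).
  rewrite {1}hX -mulmxA -map_mxM -trmx_mul vX.
  by rewrite linearZ /= map_mxZ -scalemxAr.
have vv0 : v *m v ^t* != 0.
  apply: contra v0 => /eqP vv; have := dnorm_eq0 (@dotmx R[i] n) v.
  rewrite [X in X == 0](_ : _ = 0); first by rewrite eqxx => <-.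
  by apply: etrans (dotmxE v v) _; rewrite vv mxE.
have zN : z = z^*.
  have /eqP := etrans (esym e1) e2.
  by rewrite -subr_eq0 -scalerBl scaler_eq0 (negPf vv0) orbF subr_eq0 => /eqP.
have := congr1 (@complex.Im R) zN.
case: z {zN e1 e2 vX zX} => x y /= /eqP.
by rewrite -subr_eq0 opprK -mulr2n mulrn_eq0 /= => /eqP ->.
Qed.

Lemma char_poly_eigvals n (X : 'M[R[i]]_n) : X \is hermsymmx ->
  char_poly X = \prod_(k < n) ('X - ((eigvals X 0 k)%:C)%:P).
Proof.
move=> hX; set s := sort >=%R [seq complex.Re z | z <- char_roots X].
have ss : size s = n by rewrite size_sort size_map size_char_roots.
have -> : \prod_(k < n) ('X - ((eigvals X 0 k)%:C)%:P) =
          \prod_(x <- s) ('X - (x%:C)%:P) :> {poly R[i]}.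
  rewrite (big_nth 0) ss big_mkord; apply: eq_bigr => k _.
  by rewrite /eigvals mxE.
rewrite char_rootsE (perm_big [seq complex.Re z | z <- char_roots X]) /=; last first.
  by rewrite perm_sort.
rewrite big_map big_seq [RHS]big_seq; apply: eq_bigr => z zX.
by rewrite (char_root_real hX zX).
Qed.

End HermitianEigenvalues.

(* Main.v *)
Require Import Defs.
From HB Require Import structures.
From mathcomp Require Import all_boot all_order all_algebra all_fingroup ring.
From mathcomp Require Import sesquilinear spectral.
From mathcomp.real_closed Require Import complex.
From mathcomp Require Import all_classical all_reals topology normedtype.

(** Let [U] consist of [k] orthonormal eigenvectors of [A + B], and for maps
    [f, g : 'I_k -> P] let [p f] and [q g] be the [k]-minors of [U] in the
    bases [a] and [b], i.e. the coordinates of the k-th exterior power of [U].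
    By the Cauchy-Binet formula (summing over all maps rather than over
    subsets, at the price of a factor [k!]) the minors of [C] intertwine [p]
    and [q], and the means of [alpha] and [beta] under [|p|^2] and [|q|^2] add
    up to the sum of the chosen eigenvalues.

    Let [m] be the sum of the [k] largest values of [alpha + beta]. If the
    minor at [(f, g)] of a product in L(P)U(P) is nonzero, Cauchy-Binet yields
    an injective [e] with [e <= f] and [e <= g] up to reordering, so
    [alpha(f) + beta(g) <= m]; unlike the existence of a factorization, this
    property of [C] survives limits. Hence the spectral subspace [beta >= t] is
    contained in the spectral subspace [m - alpha >= t] for all [t], and the
    layer-cake decomposition shows that the mean of [beta] is at most that of
    [m - alpha]. *)

Set Implicit Arguments.
Unset Strict Implicit.
Unset Printing Implicit Defensive.

Import Order.TTheory GRing.Theory Num.Theory.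
Import numFieldNormedType.Exports.

Local Open Scope classical_set_scope.
Local Open Scope sesquilinear_scope.
Local Open Scope complex_scope.
Local Open Scope ring_scope.

(** * Minors indexed by maps and Cauchy-Binet formulas *)

Lemma det_neq0_perm (R : comNzRingType) n (M : 'M[R]_n) :
  \det M != 0 -> exists s : 'S_n, forall i, M i (s i) != 0.
Proof.
have [/existsP[s /forallP sP] _|] := boolP
    [exists s : 'S_n, forall i, M i (s i) != 0].
  by exists s.
rewrite negb_exists => /forallP sP; rewrite /determinant big1 ?eqxx // => s _.
have /forallPn[i /negPn/eqP Mi0] := sP s.
by rewrite (bigD1 i) //= Mi0 mul0r mulr0.
Qed.

Section FunctionIndexedMinors.
Variables (R : comNzRingType) (k n : nat).
Implicit Types (X : 'M[R]_(k, n)) (Y : 'M[R]_(n, k)) (f : {ffun 'I_k -> 'I_n}).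

Lemma det_sum_rows (I : finType) (G : 'I_k -> I -> 'I_k -> R) :
  \det (\matrix_(r, s) \sum_i G r i s) =
  \sum_(f : {ffun 'I_k -> I}) \det (\matrix_(r, s) G r (f r) s).
Proof.
rewrite /determinant exchange_big /=; apply: eq_bigr => s _.
rewrite -big_distrr /=; congr (_ * _).
transitivity (\prod_r \sum_i G r i (s r)).
  by apply: eq_bigr => r _; rewrite mxE.
rewrite bigA_distr_bigA; apply: eq_bigr => f _.
by apply: eq_bigr => r _; rewrite mxE.
Qed.

Lemma det_scale_rows (c : 'I_k -> R) (M : 'M[R]_k) :
  \det (\matrix_(r, s) (c r * M r s)) = (\prod_r c r) * \det M.
Proof.
rewrite /determinant big_distrr /=; apply: eq_bigr => s _.
rewrite mulrCA -big_split /=; congr (_ * _).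
by apply: eq_bigr => r _; rewrite mxE.
Qed.

(** The Leibniz expansion of the first minor produces products of entries, which together with the
    weights are absorbed into the rows of the second minor. Multilinearity in the rows then carries
    the sum over maps inside the determinant. *)
Lemma weighted_Cauchy_Binet (w : 'I_k -> 'I_n -> R) X Y :
  \sum_(f : {ffun 'I_k -> 'I_n}) (\prod_r w r (f r)) *
    (\det (colsub f X) * \det (rowsub f Y)) =
  \sum_(s : 'S_k) (-1) ^+ s *
    \det (\matrix_(r, t) \sum_i X (s r) i * w r i * Y i t).
Proof.
transitivity (\sum_(f : {ffun 'I_k -> 'I_n}) \sum_(s : 'S_k) (-1) ^+ s *
    \det (\matrix_(r, t) (X (s r) (f r) * w r (f r) * Y (f r) t))).
  apply: eq_bigr => f _; rewrite -[\det (colsub _ _)]det_tr.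
  rewrite [\det (colsub f X)^T]/determinant big_distrl big_distrr /=.
  apply: eq_bigr => s _; rewrite -mulrA mulrCA; congr (_ * _).
  rewrite mulrA -big_split /= -det_scale_rows; congr (\det _).
  by apply/matrixP => i j; rewrite !mxE [w _ _ * _]mulrC.
rewrite exchange_big /=; apply: eq_bigr => s _.
by rewrite -big_distrr /= det_sum_rows.
Qed.

(** With unit weights each [s] merely permutes the rows of [X *m Y], and its sign cancels; the [k!]
    permutations thus contribute equally. *)
Lemma Cauchy_Binet X Y :
  \sum_(f : {ffun 'I_k -> 'I_n}) \det (colsub f X) * \det (rowsub f Y) =
  k`!%:R * \det (X *m Y).
Proof.
transitivity (\sum_(f : {ffun 'I_k -> 'I_n}) (\prod_(r < k) 1) *
    (\det (colsub f X) * \det (rowsub f Y))).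
  by apply: eq_bigr => f _; rewrite big1_eq mul1r.
rewrite (weighted_Cauchy_Binet (fun _ _ => 1)).
rewrite (eq_bigr (fun _ => \det (X *m Y))) => [|s _].
  by rewrite sumr_const card_Sn mulr_natl.
rewrite (_ : \matrix_(_, _) _ = perm_mx s *m (X *m Y)).
  by rewrite det_mulmx det_perm mulrA -signr_addb addbb mul1r.
rewrite -row_permE; apply/matrixP => i j; rewrite !mxE.
by apply: eq_bigr => l _; rewrite mulr1.
Qed.

(** Laplace expansion along row [t]: the cofactors of that row do not involve it, so they are those
    of the identity matrix. *)
Lemma det_replace_row1 (M : 'M[R]_k) (t : 'I_k) :
  (forall i j, i != t -> M i j = (i == j)%:R) -> \det M = M t t.
Proof.
move=> M1; rewrite (expand_det_row _ t).
under eq_bigr => j _.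
  rewrite (_ : cofactor M t j = cofactor 1%:M t j); last first.
    congr (_ * \det _); apply/matrixP => i l; rewrite !mxE M1 //.
    by rewrite eq_sym neq_lift.
  rewrite (_ : cofactor _ _ _ = (1%:M : 'M[R]_k) j t); last first.
    transitivity (\adj (1%:M : 'M[R]_k) j t); first by rewrite mxE.
    by rewrite -[\adj _]mul1mx mul_mx_adj det1.
  rewrite mxE; over.
rewrite (bigD1 t) //= eqxx mulr1 big1 ?addr0 // => j /negPf ->.
by rewrite mulr0.
Qed.

(* The expectation of a linear statistic of a determinantal process; for a
   weight on the row [r] only, [weighted_Cauchy_Binet] produces determinants
   all of whose other rows are rows of [X *m Y = 1]. *)
Lemma Cauchy_Binet_trace X Y (c : 'rV[R]_n) : X *m Y = 1%:M ->
  \sum_(f : {ffun 'I_k -> 'I_n}) (\sum_r c 0 (f r)) *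
    (\det (colsub f X) * \det (rowsub f Y)) =
  k`!%:R * \tr (X *m diag_mx c *m Y).
Proof.
move=> XY1; under eq_bigr do rewrite big_distrl /=.
rewrite exchange_big /=.
transitivity (\sum_(r < k) \sum_(s : 'S_k) (X *m diag_mx c *m Y) (s r) (s r)).
  apply: eq_bigr => r _.
  pose w r' i := if r' == r then c 0 i else 1.
  transitivity (\sum_(f : {ffun 'I_k -> 'I_n}) (\prod_r' w r' (f r')) *
      (\det (colsub f X) * \det (rowsub f Y))).
    apply: eq_bigr => f _; congr (_ * _); rewrite (bigD1 r) //= /w eqxx.
    by rewrite big1 ?mulr1 // => i /negPf ->.
  rewrite weighted_Cauchy_Binet /w; apply: eq_bigr => s _.
  set M := \matrix_(_, _) _.
  (* Undoing [s] moves the weighted row to index [s r] and turns every other row [i] into row [i] of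
     [X *m Y]. *)
  have -> : M = perm_mx s *m row_perm s^-1 M.
    by rewrite -row_permE -row_permM mulgV row_perm1.
  rewrite det_mulmx det_perm mulrA -signr_addb addbb mul1r.
  rewrite (@det_replace_row1 _ (s r)) => [|i j ir].
    rewrite !mxE permK eqxx; apply: eq_bigr => i _.
    by rewrite mul_mx_diag mxE.
  have -> : (i == j)%:R = (1%:M : 'M[R]_k) i j by rewrite mxE.
  rewrite -XY1 !mxE permKV (_ : s^-1%g i == r = false); last first.
    by apply: contraNF ir => /eqP <-; rewrite permKV.
  by apply: eq_bigr => l _; rewrite mulr1.
rewrite exchange_big /= (eq_bigr (fun _ => \tr (X *m diag_mx c *m Y))).
  by rewrite sumr_const card_Sn mulr_natl.
by move=> s _; rewrite /mxtrace [RHS](reindex_inj (@perm_inj _ s)).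
Qed.

End FunctionIndexedMinors.

(** * Layer-cake comparison of weighted sums *)

Section LayerCake.
Variable R : realDomainType.

(** The increments of the increasing list [t :: s] up to [x] telescope to [x - t]; the indicator
    switches off those beyond [x]. *)
Lemma telescope_indicators (t : R) (s : seq R) (x : R) :
  path <%R t s -> x \in t :: s ->
  x = t + \sum_(j < size s) (s`_j - (t :: s)`_j) * (s`_j <= x)%R%:R.
Proof.
elim: s t => [|t1 s IH] t /=; first by rewrite inE big_ord0 addr0 => _ /eqP.
move=> /andP[tt1 ps]; rewrite inE => /predU1P[->|xs].
  rewrite big1 ?addr0 // => j _.
  have /(order_path_min lt_trans)/allP t_lt : path <%R t (t1 :: s).
    by rewrite /= tt1.
  have := t_lt _ (mem_nth 0 (ltn_ord j : j < size (t1 :: s))%N).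
  by rewrite ltNge => /negPf ->; rewrite mulr0.
rewrite big_ord_recl /= (_ : t1 <= x); last first.
  move: xs; rewrite inE => /predU1P[->//|xs]; apply: ltW.
  exact: (allP (order_path_min lt_trans ps) _ xs).
by rewrite mulr1 addrA [t + _]addrC subrK; apply: IH.
Qed.

(** Over a common list of levels, each side is the lowest level times the total mass plus a
    combination of tail masses with the same nonnegative increments as coefficients. The total
    masses agree and the tails compare by hypothesis. *)
Lemma layer_cake_le (I J : finType) (p x : I -> R) (q y : J -> R) :
  \sum_i p i = \sum_j q j ->
  (forall t, \sum_(j | t <= y j) q j <= \sum_(i | t <= x i) p i) ->
  \sum_j q j * y j <= \sum_i p i * x i.
Proof.
move=> pq dom.
(* The extra level [0] guarantees that the list of levels is nonempty. *)
pose v := undup (0 :: [seq x i | i <- enum I] ++ [seq y j | j <- enum J]).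
case E : (sort <=%R v) => [|t s].
  have : 0 \in sort <=%R v by rewrite mem_sort mem_undup mem_head.
  by rewrite E.
have ps : path <%R t s.
  have : sorted <%R (sort <=%R v) by rewrite sort_lt_sorted undup_uniq.
  by rewrite E.
have decomp (K : finType) (w z : K -> R) : (forall k, z k \in v) ->
    \sum_k w k * z k = t * \sum_k w k +
      \sum_(j < size s) (s`_j - (t :: s)`_j) * \sum_(k | s`_j <= z k) w k.
  move=> zv; transitivity (\sum_k (t * w k +
      \sum_(j < size s) (s`_j - (t :: s)`_j) * ((s`_j <= z k)%R%:R * w k))).
    apply: eq_bigr => k _.
    rewrite {1}(telescope_indicators ps (_ : z k \in _)); last first.
      by rewrite -E mem_sort zv.
    rewrite mulrC mulrDl big_distrl /=; congr (_ + _).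
    by apply: eq_bigr => j _; rewrite mulrA.
  rewrite big_split /= -big_distrr /= exchange_big /=; congr (_ + _).
  apply: eq_bigr => j _; rewrite -big_distrr /= [in RHS]big_mkcond /=.
  by congr (_ * _); apply: eq_bigr => k _; case: ifP; rewrite (mul1r, mul0r).
rewrite (decomp _ q y) => [|j]; last first.
  by rewrite mem_undup inE mem_cat map_f ?mem_enum ?orbT.
rewrite (decomp _ p x) => [|i]; last first.
  by rewrite mem_undup inE mem_cat map_f ?mem_enum ?orbT.
rewrite pq lerD2l ler_sum // => j _; rewrite ler_wpM2l // subr_ge0.
have /(pathP 0)/(_ j (ltn_ord j)) := ps; exact: ltW.
Qed.

End LayerCake.

(** * Comparison of masses on two spectral subspaces *)

Lemma kernel_domination (F : numClosedFieldType) (I J : finType)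
    (K : I -> J -> F) (p : I -> F) (q : J -> F) (c : F)
    (S : pred I) (G : pred J) :
  0 < c ->
  (forall i j, G j -> K i j != 0 -> S i) ->
  (forall j, G j -> \sum_i (K i j)^* * p i = c * q j) ->
  (forall j, G j -> \sum_i (K i j)^* * (\sum_(l | G l) K i l * q l) =
                    c * (c * q j)) ->
  \sum_(j | G j) `|q j| ^+ 2 <= \sum_(i | S i) `|p i| ^+ 2.
Proof.
(* [h], the image under [K] of [q] restricted to [G], is supported in [S];
   expand [0 <= \sum_(i | S i) `|c * p i - h i| ^+ 2]. *)
move=> c0 KS Kp Kq; pose h i := \sum_(j | G j) K i j * q j.
have cE : c^* = c by apply/CrealP/gtr0_real.
have hS i : ~~ S i -> h i = 0.
  move=> Si; apply: big1 => j Gj; have [->|/(KS _ _ Gj)] := eqVneq (K i j) 0.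
    by rewrite mul0r.
  by rewrite (negPf Si).
have hx (x : I -> F) : \sum_(i | S i) (h i)^* * x i =
    \sum_(j | G j) (q j)^* * \sum_i (K i j)^* * x i.
  transitivity (\sum_i (h i)^* * x i).
    rewrite [RHS](bigID S) /= [X in _ + X]big1 ?addr0 // => i /hS ->.
    by rewrite conjC0 mul0r.
  transitivity (\sum_i \sum_(j | G j) (q j)^* * ((K i j)^* * x i)).
    apply: eq_bigr => i _; rewrite rmorph_sum big_distrl /=.
    by apply: eq_bigr => j _; rewrite rmorphM mulrCA mulrA.
  by rewrite exchange_big /=; apply: eq_bigr => j _; rewrite big_distrr.
set Q := \sum_(j | _) _; set P := \sum_(i | _) _.
have hp : \sum_(i | S i) (h i)^* * p i = c * Q.
  rewrite hx big_distrr /=; apply: eq_bigr => j Gj.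
  by rewrite Kp // normCK mulrCA [q j * _]mulrC.
have hh : \sum_(i | S i) (h i)^* * h i = c * (c * Q).
  rewrite hx !big_distrr /=; apply: eq_bigr => j Gj.
  by rewrite Kq // normCK mulrCA [_^* * _]mulrCA [q j * _]mulrC.
have Qr : Q^* = Q.
  by apply/CrealP/ger0_real/sumr_ge0 => j _; rewrite exprn_ge0.
have : 0 <= \sum_(i | S i) `|c * p i - h i| ^+ 2.
  by apply: sumr_ge0 => i _; rewrite exprn_ge0.
rewrite (_ : \sum_(i | _) _ = c * (c * P) - c * (c * Q)).
  by rewrite subr_ge0 !ler_pM2l.
have hp' : \sum_(i | S i) h i * (p i)^* = c * Q.
  rewrite -[c * Q]conjCK rmorphM /= cE Qr -hp rmorph_sum /=.
  by apply: eq_bigr => i _; rewrite rmorphM /= conjCK.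
(* The three copies of [c * (c * Q)] stand for the two cross terms of the expanded square and for
   the squared norm of [h]. *)
transitivity (c * (c * P) - c * (c * Q) - c * (c * Q) + c * (c * Q)); last ring.
rewrite -[in X in _ = _ + X]hh -[in X in _ = _ - X + _]hp'.
rewrite -[in X in _ = _ - X - _ + _]hp.
rewrite !big_distrr /= -!sumrB -big_split /=; apply: eq_bigr => i _.
rewrite !normCK rmorphB rmorphM /= cE; ring.
Qed.

(** * From vanishing minors to a bound on traces *)

Section TraceBound.
Variables (R : rcfType) (n k : nat).
Implicit Types (f g : {ffun 'I_k -> 'I_n}) (X Y : 'M[R[i]]_(n, k)).

Lemma conjC_det_rowsub (f : 'I_k -> 'I_n) X :
  (\det (rowsub f X))^* = \det (colsub f (X ^t*)).
Proof.
rewrite -det_tr -det_map_mx; congr (\det _).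
by apply/matrixP => i j; rewrite !mxE.
Qed.

(** [X] and [Y] are the coordinates of one orthonormal [k]-frame in two bases. The squared moduli of
    their minors are weights of total mass [k!], and by [Cauchy_Binet_trace] the two traces are the
    means of [u] and [v] under them, so the layer-cake comparison applies. *)
Lemma trace_bound (C : 'M[R[i]]_n) X Y (u v : 'I_n -> R) (m : R) :
  C ^t* *m C = 1%:M -> X = C *m Y -> Y ^t* *m Y = 1%:M ->
  (forall f g, \det (mxsub f g C) != 0 ->
     \sum_r u (f r) + \sum_r v (g r) <= m) ->
  \tr (X ^t* *m diag_mx (\row_i (u i)%:C) *m X) +
  \tr (Y ^t* *m diag_mx (\row_i (v i)%:C) *m Y) <= m%:C.
Proof.
move=> CC XE YY minors.
have YX : Y = C ^t* *m X by rewrite XE mulmxA CC mul1mx.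
have XX : X ^t* *m X = 1%:M.
  by rewrite {1}XE trmx_mul map_mxM -mulmxA -YX.
have k0 : 0 < k`!%:R :> R[i] by rewrite ltr0n fact_gt0.
pose U f := \sum_r u (f r); pose V g := \sum_r v (g r).
pose P f := \det (rowsub f X); pose Q g := \det (rowsub g Y).
pose K f g := \det (mxsub f g C).
have Kc f g : (K f g)^* = \det (colsub f ((colsub g C) ^t*)).
  rewrite -conjC_det_rowsub; congr (\det _)^*.
  by apply/matrixP => i j; rewrite !mxE.
have Kp g : \sum_f (K f g)^* * P f = k`!%:R * Q g.
  under eq_bigr do rewrite Kc.
  rewrite Cauchy_Binet /Q YX; congr (_ * \det _).
  by apply/matrixP => i j; rewrite !mxE; apply: eq_bigr => l _; rewrite !mxE.
have KK g h : \sum_f (K f g)^* * K f h = k`!%:R * \det (mxsub g h 1%:M).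
  have KE f : K f h = \det (rowsub f (colsub h C)).
    by congr (\det _); apply/matrixP => i j; rewrite !mxE.
  under eq_bigr do rewrite Kc KE.
  rewrite Cauchy_Binet -CC; congr (_ * \det _).
  by apply/matrixP => i j; rewrite !mxE; apply: eq_bigr => l _; rewrite !mxE.
have dom t : \sum_(g | t <= V g) `|Q g| ^+ 2 <=
             \sum_(f | t <= m - U f) `|P f| ^+ 2.
  (* The constant is [k!] because sums over all maps count each [k]-subset once per ordering. *)
  apply: (@kernel_domination _ _ _ K _ _ k`!%:R) => //.
  - move=> f g tV /minors fg; apply: le_trans tV _.
    by rewrite lerBrDl.
  - move=> g tV; under eq_bigr do rewrite big_distrr /=.
    rewrite exchange_big /=.
    under eq_bigr => h _ do
      (under eq_bigr do rewrite mulrA; rewrite -big_distrl /= KK -mulrA).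
    rewrite -big_distrr /=; congr (_ * _).
    transitivity (\sum_(h : {ffun 'I_k -> 'I_n})
        \det (colsub h (rowsub g 1%:M)) * Q h).
      rewrite [RHS](bigID (fun h => t <= V h)) /= [X in _ + X]big1 ?addr0.
        apply: eq_bigr => h _; congr (\det _ * _).
        by apply/matrixP => i j; rewrite !mxE.
      move=> h; apply: contraNeq; rewrite mulf_eq0 negb_or.
      case/andP => /det_neq0_perm[s sP] _; rewrite (_ : V h = V g) //.
      rewrite /V [LHS](reindex_inj (@perm_inj _ s)); apply: eq_bigr => r _.
      have := sP r; rewrite !mxE.
      by case: (eqVneq (g r)) => [->|]; rewrite ?eqxx.
    rewrite Cauchy_Binet; congr (_ * \det _).
    by rewrite mul_rowsub_mx mul1mx.
(* The layer-cake lemma needs a total order, so squared moduli are recast as elements of [R]. *)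
pose sq (z : R[i]) := complex.Re z ^+ 2 + complex.Im z ^+ 2.
have sqE z : (sq z)%:C = `|z| ^+ 2 by apply: add_Re2_Im2.
have total Z : Z ^t* *m Z = 1%:M ->
    \sum_(f : {ffun 'I_k -> 'I_n}) sq (\det (rowsub f Z)) = k`!%:R.
  move=> ZZ; apply: (@complexI R); rewrite rmorph_sum /= rmorph_nat.
  have := Cauchy_Binet (Z ^t*) Z; rewrite ZZ det1 mulr1 => <-.
  by apply: eq_bigr => f _; rewrite sqE normCK -conjC_det_rowsub mulrC.
have mean Z (w : 'I_n -> R) : Z ^t* *m Z = 1%:M ->
    (\sum_(f : {ffun 'I_k -> 'I_n})
        sq (\det (rowsub f Z)) * \sum_r w (f r))%:C =
    k`!%:R * \tr (Z ^t* *m diag_mx (\row_i (w i)%:C) *m Z).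
  move=> ZZ; rewrite -Cauchy_Binet_trace // rmorph_sum /=.
  apply: eq_bigr => f _; rewrite rmorphM /= sqE normCK -conjC_det_rowsub.
  rewrite mulrC [_^* * _]mulrC rmorph_sum /=; congr (_ * _).
  by apply: eq_bigr => r _; rewrite mxE.
have : \sum_g sq (Q g) * V g <= \sum_f sq (P f) * (m - U f).
  apply: layer_cake_le => [|t]; first by rewrite !total.
  rewrite -lecR !rmorph_sum /=.
  by under eq_bigr do rewrite sqE; under [leRHS]eq_bigr do rewrite sqE.
under [leRHS]eq_bigr do rewrite mulrBr.
rewrite sumrB -big_distrl /= total // lerBrDl -lecR rmorphD rmorphM /= !mean //.
by rewrite rmorph_nat -mulrDr ler_pM2l.
Qed.
End TraceBound.

(** * Decreasing rearrangements and their partial sums *)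

Section Rearrangement.
Variables (R : realType) (n : nat).
Implicit Types (x y : 'rV[R]_n).

Lemma decreasing_rearrangement_perm x :
  exists s : 'S_n, forall i, decreasing_rearrangement x 0 i = x 0 (s i).
Proof.
have : perm_eq (sort >=%R [seq x 0 j | j <- enum 'I_n]) [tuple x 0 j | j < n].
  by rewrite perm_sort.
case/tuple_permP => s sE; exists s => i; rewrite mxE sE.
by rewrite -tnth_nth !tnth_mktuple.
Qed.

Lemma decreasing_rearrangement_anti x (i j : 'I_n) : (i <= j)%N ->
  decreasing_rearrangement x 0 j <= decreasing_rearrangement x 0 i.
Proof.
move=> ij; rewrite !mxE; set s := sort _ _.
have sz : size s = n by rewrite size_sort size_map size_enum_ord.
have ss : sorted >=%R s by apply: sort_sorted => a b; apply: ge_total.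
by apply: (sorted_leq_nth ge_trans ge_refl 0 ss); rewrite ?inE ?sz.
Qed.

Lemma decreasing_rearrangement_id x :
  decreasing_rearrangement (decreasing_rearrangement x) =
  decreasing_rearrangement x.
Proof.
apply/rowP => i; rewrite 2!mxE; set s := sort _ [seq x 0 j | j <- _].
have sz : size s = n by rewrite size_sort size_map size_enum_ord.
rewrite (_ : [seq _ | j <- _] = s).
  by rewrite sorted_sort ?mxE //; [exact: ge_trans|exact/sort_sorted/ge_total].
apply: (@eq_from_nth _ 0); rewrite size_map size_enum_ord ?sz // => j jn.
by rewrite (nth_map (Ordinal jn)) ?size_enum_ord // mxE nth_enum_ord.
Qed.

Lemma sum_decreasing_rearrangement x :
  \sum_i decreasing_rearrangement x 0 i = \sum_i x 0 i.
Proof.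
have [s sE] := decreasing_rearrangement_perm x.
by rewrite [RHS](reindex_inj (@perm_inj _ s)); apply: eq_bigr.
Qed.

(** Let [c] be the smallest of the leading entries being summed, and subtract it from every term.
    Any selection of excesses over [c] is at most the sum of all positive parts, and the leading
    entries attain that sum, since later entries have no positive excess. *)
Lemma sum_inj_le k x (h : 'I_k -> 'I_n) : injective h ->
  \sum_r x 0 (h r) <= \sum_(i < n | (i < k)%N) decreasing_rearrangement x 0 i.
Proof.
case: k h => [|k] h hI; first by rewrite big_ord0 big_pred0_eq.
have kn : (k < n)%N by have := leq_card h hI; rewrite !card_ord.
have [s sE] := decreasing_rearrangement_perm x.
set y := decreasing_rearrangement x in sE *.
pose g r := s^-1%g (h r); pose c := y 0 (Ordinal kn).
have gI : injective g by move=> r t /perm_inj /hI.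
rewrite (eq_bigr (fun r => y 0 (g r))) => [|r _]; last by rewrite sE permKV.
rewrite -(lerD2r (- \sum_(r < k.+1) c)) -sumrB.
rewrite [in leRHS](big_ord_narrow kn) -sumrB.
apply: (@le_trans _ _ (\sum_r Num.max (y 0 (g r) - c) 0)).
  by apply: ler_sum => r _; rewrite le_max lexx.
apply: (@le_trans _ _ (\sum_i Num.max (y 0 i - c) 0)).
  rewrite -(big_imset (fun i => Num.max (y 0 i - c) 0)) /=; last first.
    by move=> r t _ _ /gI.
  rewrite [leRHS](bigID (mem (g @: predT))) /= lerDl.
  by apply: sumr_ge0 => i _; rewrite le_max lexx orbT.
rewrite (bigID (fun i : 'I_n => (i < k.+1)%N)) /= [X in _ + X]big1 ?addr0.
  rewrite (big_ord_narrow kn); apply: ler_sum => r _.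
  by rewrite ge_max lexx subr_ge0 decreasing_rearrangement_anti //= -ltnS.
move=> i; rewrite -leqNgt => ki; apply/eqP; rewrite eq_maxr // subr_le0.
by rewrite decreasing_rearrangement_anti // ltnW.
Qed.

Lemma sum_top_inj k x : (k <= n)%N -> exists2 h : 'I_k -> 'I_n, injective h &
  \sum_(i < n | (i < k)%N) decreasing_rearrangement x 0 i = \sum_r x 0 (h r).
Proof.
move=> kn; have [s sE] := decreasing_rearrangement_perm x.
exists (fun r => s (widen_ord kn r)) => [r t /perm_inj /(congr1 val)|].
  by move=> /= rt; apply: val_inj.
by rewrite (big_ord_narrow kn); apply: eq_bigr => r _; rewrite sE.
Qed.

End Rearrangement.

(** * Minors of limits of products in L(P)U(P) *)

Lemma minor_continuous (R : realType) n k (f g : 'I_k -> 'I_n) :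
  continuous (fun M : 'M[R[i]]_n => \det (mxsub f g M)).
Proof.
apply: continuous_big => [|s _].
  by move=> z; apply: cvgD; [exact: cvg_fst|exact: cvg_snd].
have prodc : continuous (fun M : 'M[R[i]]_n => \prod_r mxsub f g M r (s r)).
  apply: continuous_big => [|r _ M].
    by move=> z; apply: cvgM; [exact: cvg_fst|exact: cvg_snd].
  under eq_fun do rewrite mxE.
  exact: coord_continuous.
by move=> M; exact: (cvgM (cvg_cst _) (prodc M)).
Qed.

(** Nonvanishing of a minor is an open condition, so it holds on a neighbourhood of [C], which meets
    [S]. *)
Lemma closure_minor_neq0 (R : realType) n k (f g : 'I_k -> 'I_n)
    (S : set 'M[R[i]]_n) (C : 'M[R[i]]_n) :
  closure S C -> \det (mxsub f g C) != 0 ->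
  exists2 D, S D & \det (mxsub f g D) != 0.
Proof.
move=> SC C0.
have [D [SD D0]] := SC _ (cvgr_neq0 _ (@minor_continuous R n k f g C) C0).
by exists D.
Qed.

Section PosetMinors.
Variables (R : realType) (d : Order.disp_t) (P : finPOrderType d).

(** Some Cauchy-Binet term is nonzero. Its index [e] is injective, as a repeated row would kill the
    minor of [U], and a nonzero Leibniz term in each factor gives the order relations through the
    supports of [L] and [U]. *)
Lemma LU_minor_neq0 k (L U : 'M[R[i]]_#|P|) (f g : {ffun 'I_k -> 'I_#|P|}) :
  lower_mx L -> upper_mx U -> \det (mxsub f g (L *m U)) != 0 ->
  exists e : 'I_k -> 'I_#|P|, [/\ injective e,
    exists s : 'S_k, forall r, (enum_val (e (s r)) <= enum_val (f r))%O &
    exists s : 'S_k, forall r, (enum_val (e r) <= enum_val (g (s r)))%O].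
Proof.
move=> Llow Uup fg.
have : \sum_(e : {ffun 'I_k -> 'I_#|P|})
    \det (colsub e (rowsub f L)) * \det (rowsub e (colsub g U)) != 0.
  rewrite Cauchy_Binet mulf_neq0 ?pnatr_eq0 -?lt0n ?fact_gt0 //.
  apply: contraNneq fg => <-; apply/eqP; congr (\det _).
  by apply/matrixP => i j; rewrite !mxE; apply: eq_bigr => l _; rewrite !mxE.
move=> sum0; pose F (e : {ffun 'I_k -> 'I_#|P|}) :=
  \det (colsub e (rowsub f L)) * \det (rowsub e (colsub g U)).
have [e|F0] := pickP (fun e => F e != 0); last first.
  by move: sum0; rewrite big1 ?eqxx // => e _; apply/eqP/negbFE/F0.
rewrite mulf_eq0 negb_or => /andP[fe eg] {sum0}.
exists e; split.
- move=> r t ert; apply/eqP; apply: contraNT eg => rt.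
  apply/eqP/(determinant_alternate rt) => j.
  by rewrite !mxE ert.
- have [s sP] := det_neq0_perm fe; exists s => r.
  have := sP r; rewrite !mxE; apply: contraNT => ler.
  by rewrite -[f r]enum_valK -[e _]enum_valK; apply/eqP/Llow.
- have [s sP] := det_neq0_perm eg; exists s => r.
  have := sP r; rewrite !mxE; apply: contraNT => ler.
  by rewrite -[g _]enum_valK -[e _]enum_valK; apply/eqP/Uup.
Qed.

(** Since [alpha] and [beta] are order-decreasing, replacing [f] and [g] by the common lower map [e]
    can only increase both sums; injectivity of [e] then bounds their total by the largest values of
    [alpha + beta]. *)
Lemma closure_LU_minor_bound (alpha beta : P -> R) k (C : 'M[R[i]]_#|P|)
    (f g : {ffun 'I_k -> 'I_#|P|}) :
  order_decreasing alpha -> order_decreasing beta ->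
  closure (@lower_upper_mx R d P) C -> \det (mxsub f g C) != 0 ->
  \sum_r alpha (enum_val (f r)) + \sum_r beta (enum_val (g r)) <=
  \sum_(i < #|P| | (i < k)%N)
    decreasing_rearrangement
      (\row_j (alpha (enum_val j) + beta (enum_val j))) 0 i.
Proof.
move=> alphaD betaD CLU /(closure_minor_neq0 CLU)[_ [L Llow [U Uup <-]]].
case/(LU_minor_neq0 Llow Uup) => e [eI [s sP] [t tP]].
apply: le_trans (sum_inj_le _ eI).
under [leRHS]eq_bigr do rewrite mxE; rewrite big_split /=.
rewrite [X in _ <= X + _](reindex_inj (@perm_inj _ s)).
rewrite [X in _ + X <= _](reindex_inj (@perm_inj _ t)).
by apply: lerD; apply: ler_sum => r _; [apply: alphaD|apply: betaD].
Qed.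

End PosetMinors.

(** * Eigenvalues and traces under diagonalization *)

Section UnitaryDiagonalization.
Variables (R : realType) (n : nat).
Implicit Types (X V W : 'M[R[i]]_n) (d : 'rV[R]_n).

Lemma char_poly_conj X V W : V *m W = 1%:M ->
  char_poly (V *m X *m W) = char_poly X.
Proof.
move=> VW; rewrite /char_poly /char_poly_mx.
have VWp : map_mx polyC V *m map_mx polyC W = 1%:M.
  by rewrite -map_mxM VW map_mx1.
have -> : 'X%:M - map_mx polyC (V *m X *m W) =
    map_mx polyC V *m ('X%:M - map_mx polyC X) *m map_mx polyC W.
  rewrite !map_mxM mulmxBr mulmxBl; congr (_ - _).
  by rewrite scalar_mxC -mulmxA VWp mulmx1.
by rewrite !det_mulmx mulrAC -det_mulmx VWp det1 mul1r.
Qed.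

Lemma eigvals_diag_conj V W d : V *m W = 1%:M ->
  eigvals (V *m diag_mx (map_mx (real_complex R) d) *m W) =
  decreasing_rearrangement d.
Proof.
move=> VW; set X := _ *m W.
have : perm_eq (char_roots X) [seq (d 0 j)%:C | j <- enum 'I_n].
  apply: prod_XsubC_eq; rewrite -char_rootsE char_poly_conj //.
  rewrite char_poly_trig ?diag_mx_is_trig // big_map big_enum.
  by apply: eq_bigr => j _; rewrite !mxE eqxx.
move=> /(perm_map (@complex.Re R)); rewrite -map_comp => dX.
rewrite /eigvals /decreasing_rearrangement.
by rewrite (perm_sortP (@ge_total _ R) ge_trans ge_anti _ _ dX).
Qed.

Lemma hermitian_diagonalization X : X \is hermsymmx ->
  exists W d, W ^t* *m W = 1%:M /\
    X = W *m diag_mx (map_mx (real_complex R) d) *m W ^t*.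
Proof.
move=> Xh; have /orthomx_spectralP XE := hermitian_normalmx Xh.
have Pu := spectral_unitarymx X.
exists ((spectralmx X) ^t*), (map_mx (@complex.Re R) (spectral_diag X)).
rewrite trmxCK; split; first exact/unitarymxP.
rewrite {1}XE (invmx_unitary Pu); congr (_ *m diag_mx _ *m _).
apply/matrixP => i j; rewrite !mxE ord1.
have /mxOverP/(_ 0 j) := hermitian_spectral_diag_real Xh.
by move/RRe_real.
Qed.

Lemma trace_diag_conj V W d : V *m W = 1%:M ->
  \tr (V *m diag_mx (map_mx (real_complex R) d) *m W) = (\sum_i d 0 i)%:C.
Proof.
move=> /mulmx1C WV; rewrite mxtrace_mulC mulmxA WV mul1mx mxtrace_diag.
by rewrite rmorph_sum; apply: eq_bigr => i _; rewrite mxE.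
Qed.

End UnitaryDiagonalization.

(** * Coordinates in the two bases and sums of eigenvalues *)

Section BasisMatrix.
Variables (R : realType) (T : finType) (n : nat).

Definition basis_mx (a : T -> 'cV[R[i]]_n) : 'M[R[i]]_(n, #|T|) :=
  \matrix_(i, k) a (enum_val k) i 0.

Lemma mul_basis_mxC (a b : T -> 'cV[R[i]]_n) :
  (basis_mx a) ^t* *m basis_mx b = overlap_mx a b.
Proof.
apply/matrixP => k l; rewrite !mxE /inner mxE; apply: eq_bigr => i _.
by rewrite !mxE.
Qed.

Lemma basis_mx_unitary (a : T -> 'cV[R[i]]_n) : orthonormal_basis a ->
  (basis_mx a) ^t* *m basis_mx a = 1%:M.
Proof.
move=> [ao _]; rewrite mul_basis_mxC; apply/matrixP => k l.
by rewrite !mxE ao (inj_eq enum_val_inj).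
Qed.

Lemma spectral_sumE (f : T -> R) (a : T -> 'cV[R[i]]_n) :
  spectral_sum f a = basis_mx a *m
    diag_mx (map_mx (real_complex R) (\row_k f (enum_val k))) *m
    (basis_mx a) ^t*.
Proof.
apply/matrixP => i j; rewrite /spectral_sum summxE mul_mx_diag mxE.
rewrite (reindex (@enum_val _ T)) /=; last first.
  exact/onW_bij/enum_val_bij.
apply: eq_bigr => k _; rewrite !mxE big_ord1 !mxE.
by rewrite mulrA [_%:C * _]mulrC.
Qed.

Lemma spectral_sum_hermsym (f : T -> R) (a : T -> 'cV[R[i]]_n) :
  (spectral_sum f a) ^t* = spectral_sum f a.
Proof.
rewrite spectral_sumE !trmx_mul !map_mxM trmxCK mulmxA tr_diag_mx.
congr (_ *m _ *m _); apply/matrixP => k l; rewrite !mxE rmorphMn /=.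
by congr (_ *+ _); rewrite -[RHS]conjc_real.
Qed.

End BasisMatrix.

(** The chosen eigenvalues add up to the trace of the compression of the matrix sum to the
    eigenvectors selected by [h]. Written in the coordinates of [a] and [b], this trace splits into
    the two traces of [trace_bound]. *)
Lemma sum_top_eigvals_le (R : realType) (d : Order.disp_t) (P : finPOrderType d)
    (alpha beta : P -> R) (a b : P -> 'cV[R[i]]_#|P|)
    (W : 'M[R[i]]_#|P|) (l : 'rV[R]_#|P|) k (h : 'I_k -> 'I_#|P|) (m : R) :
  orthonormal_basis a -> orthonormal_basis b ->
  W ^t* *m W = 1%:M ->
  spectral_sum alpha a + spectral_sum beta b =
    W *m diag_mx (map_mx (real_complex R) l) *m W ^t* ->
  (forall f g : {ffun 'I_k -> 'I_#|P|},
     \det (mxsub f g (overlap_mx a b)) != 0 ->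
     \sum_r alpha (enum_val (f r)) + \sum_r beta (enum_val (g r)) <= m) ->
  injective h -> \sum_r l 0 (h r) <= m.
Proof.
move=> /basis_mx_unitary aa /basis_mx_unitary bb WW ABE minors hI.
pose U := colsub h W.
have UU : U ^t* *m U = 1%:M.
  transitivity (mxsub h h (W ^t* *m W)).
    by apply/matrixP => i j; rewrite !mxE; apply: eq_bigr => r _; rewrite !mxE.
  by rewrite WW; apply/matrixP => i j; rewrite !mxE (inj_eq hI).
pose X := (basis_mx a) ^t* *m U; pose Y := (basis_mx b) ^t* *m U.
have cancel p (V : 'M[R[i]]_#|P|) (M : 'M[R[i]]_(#|P|, p)) :
    V ^t* *m V = 1%:M -> V *m (V ^t* *m M) = M.
  by move=> /mulmx1C VV; rewrite mulmxA VV mul1mx.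
have CC : (overlap_mx a b) ^t* *m overlap_mx a b = 1%:M.
  by rewrite -mul_basis_mxC trmx_mul map_mxM trmxCK -mulmxA cancel.
have XE : X = overlap_mx a b *m Y.
  by rewrite -mul_basis_mxC -mulmxA cancel.
have adj (V : 'M[R[i]]_#|P|) : (V ^t* *m U) ^t* = U ^t* *m V.
  by rewrite trmx_mul map_mxM trmxCK.
have YY : Y ^t* *m Y = 1%:M by rewrite adj -mulmxA cancel.
have diagE (u : 'I_#|P| -> R) :
    \row_i (u i)%:C = map_mx (real_complex R) (\row_i u i).
  by apply/rowP => i; rewrite !mxE.
have sumE : \tr (U ^t* *m (spectral_sum alpha a + spectral_sum beta b) *m U) =
    (\sum_r l 0 (h r))%:C.
  have UW : U ^t* *m W = rowsub h 1%:M.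
    rewrite -WW; apply/matrixP => i j; rewrite !mxE.
    by apply: eq_bigr => r _; rewrite !mxE.
  have WU : W ^t* *m U = colsub h 1%:M by rewrite -WW mulmx_colsub.
  rewrite ABE !mulmxA UW -mulmxA WU mul_rowsub_mx mul1mx mulmx_colsub mulmx1.
  rewrite rmorph_sum; apply: eq_bigr => r _.
  by rewrite !mxE eqxx.
have := @trace_bound _ _ _ _ X Y (alpha \o enum_val) (beta \o enum_val) m
  CC XE YY minors.
rewrite !adj !diagE -lecR -sumE mulmxDr mulmxDl mxtraceD !spectral_sumE.
by rewrite !mulmxA.
Qed.

(** * The two majorization relations *)

Theorem theorem1 (R : realType) (d : Order.disp_t) (P : finPOrderType d)
    (alpha beta : P -> R)
    (halpha : order_decreasing alpha) (hbeta : order_decreasing beta)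
    (a b : P -> 'cV[R[i]]_#|P|)
    (ha : orthonormal_basis a) (hb : orthonormal_basis b)
    (A B : 'M[R[i]]_#|P|)
    (hA : A = spectral_sum alpha a) (hB : B = spectral_sum beta b)
    (hC : closure (@lower_upper_mx R d P) (overlap_mx a b)) :
  majorized (eigvals (A + B))
            (eigvals (diag_fun_mx (fun x : P => alpha x + beta x))) /\
  majorized (eigvals (diag_fun_mx (fun x : P => alpha x + beta x)))
            (eigvals A + eigvals B).
Proof.
pose u := \row_k alpha (@enum_val P predT k).
pose v := \row_k beta (@enum_val P predT k).
pose w : 'rV_#|P| := \row_k (alpha (enum_val k) + beta (enum_val k)).
have aa := mulmx1C (basis_mx_unitary ha).
have bb := mulmx1C (basis_mx_unitary hb).
have eA : eigvals A = decreasing_rearrangement u.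
  by rewrite hA spectral_sumE eigvals_diag_conj.
have eB : eigvals B = decreasing_rearrangement v.
  by rewrite hB spectral_sumE eigvals_diag_conj.
have eD : eigvals (diag_fun_mx (fun x : P => alpha x + beta x)) =
    decreasing_rearrangement w.
  rewrite -(eigvals_diag_conj w (mulmx1 1%:M)) mul1mx mulmx1.
  by congr (eigvals (diag_mx _)); apply/rowP => k; rewrite !mxE.
have /hermitian_diagonalization[W [l [WW ABE]]] : A + B \is hermsymmx.
  apply/is_hermitianmxP; rewrite expr0 scale1r linearD /= map_mxD hA hB.
  by rewrite !spectral_sum_hermsym.
have eAB : eigvals (A + B) = decreasing_rearrangement l.
  by rewrite ABE eigvals_diag_conj //; apply: mulmx1C.
(* Equality of the full sums comes from additivity of the trace. *)
have sumAB : \sum_i l 0 i = \sum_i u 0 i + \sum_i v 0 i.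
  apply: (@complexI R); rewrite rmorphD /= -(trace_diag_conj _ (mulmx1C WW)).
  by rewrite -ABE hA hB mxtraceD !spectral_sumE !trace_diag_conj.
have sumD : \sum_i w 0 i = \sum_i u 0 i + \sum_i v 0 i.
  by rewrite -big_split /=; apply: eq_bigr => i _; rewrite !mxE.
rewrite /majorized eA eB eD eAB !decreasing_rearrangement_id; split; split.
(* Here [h] selects the [k] largest eigenvalues of [A + B]. *)
- move=> k /andP[_ kn]; have [h hI ->] := sum_top_inj l kn.
  rewrite hA hB in ABE; apply: (sum_top_eigvals_le ha hb WW ABE _ hI) => f g.
  exact: closure_LU_minor_bound.
- by rewrite !sum_decreasing_rearrangement sumAB sumD.
(* The indices [h] that are optimal for [alpha + beta] are admissible, though perhaps not optimal,
   for [alpha] and for [beta] separately. *)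
- move=> k /andP[_ kn]; have [h hI ->] := sum_top_inj w kn.
  (* [majorized] rearranges the sum of the two spectra once more; its first [k] entries are just one
     injective selection, bounded by the rearranged partial sum. *)
  apply: (@le_trans _ _ (\sum_r (decreasing_rearrangement u +
      decreasing_rearrangement v) 0 (widen_ord kn r))); last first.
    by apply: sum_inj_le => r t /(congr1 val) /= rt; apply: val_inj.
  rewrite (eq_bigr (fun r => u 0 (h r) + v 0 (h r))) => [|r _]; last first.
    by rewrite !mxE.
  under [leRHS]eq_bigr do rewrite mxE.
  rewrite !big_split /=.
  apply: lerD; apply: le_trans (sum_inj_le _ hI) _.
    by rewrite (big_ord_narrow kn).
  by rewrite (big_ord_narrow kn).
- rewrite !sum_decreasing_rearrangement sumD.
  rewrite -(sum_decreasing_rearrangement u) -(sum_decreasing_rearrangement v).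
  by rewrite -big_split /=; apply: eq_bigr => i _; rewrite [RHS]mxE.
Qed.
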